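(* Let $(X,d)$ be a Hadamard space and let $A \subset X$ be a nonempty finite set. Let $x \in X \setminus A$ be a point at which the tangent cone $T_xX$ is isometric to a Euclidean space. For $a \in A$ let $v_a = \big([\,[x,a]\,], d(a,x)\big) \in T_xX$. Then the mean deficit $\mathrm{def}_A(x)$ equals the length of the shortest convex combination in $T_xX$ of the vectors $v_a$ ($a \in A$), that is, $\mathrm{def}_A(x) = \min\{ |\sum_{a\in A} w_a v_a| : w \in \mathbb{R}^A,\ w_a \ge 0\ \forall a \in A,\ \sum_{a\in A} w_a = 1\}$.
   Context: A Hadamard space is a complete CAT(0) geodesic space. $\angle$ denotes the Alexandrov angle. For $\alpha \in \mathbb{R}$ write $\alpha^+ = \max\{\alpha,0\}$. For a nonempty finite set $A \subset X$, the mean deficit at a point $x \in X\setminus A$ is $$\mathrm{def}_A(x) = \Big( \sup_{y \in X,\, y \ne x}\ \min_{a \in A} \{ d(a,x) \cos\angle a x y \} \Big)^+ .$$ The tangent cone $T_xX$ is the metric (Euclidean) cone over the space of directions at $x$: its elements are pairs $([\gamma],r)$ with $r \ge 0$, where $\gamma$ is a nonconstant geodesic starting at $x$ and $[\gamma]$ is the class of geodesics making Alexandrov angle zero with $\gamma$ at $x$; all pairs with $r=0$ are identified (the apex). It carries the scalar product $\langle ([\gamma],r),([\gamma'],r')\rangle = r r' \cos\angle(\gamma,\gamma')$ and the metric given by $d^2(([\gamma],r),([\gamma'],r')) = r^2 + r'^2 - 2 r r'\cos\angle(\gamma,\gamma')$. When $T_xX$ is isometric to a (finite-dimensional) Euclidean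 space, it is identified with that space with the apex corresponding to the origin, so that the scalar product becomes the Euclidean inner product, and convex combinations and length (norm) $|\cdot|$ are taken in that Euclidean space. *)

(* Defs.v *)
From HB Require Import structures.
From mathcomp Require Import all_boot all_order all_algebra finmap.
From mathcomp Require Import all_classical all_reals all_analysis.

Set Implicit Arguments.
Unset Strict Implicit.
Unset Printing Implicit Defensive.

Import Order.TTheory GRing.Theory Num.Theory.
Import numFieldNormedType.Exports.

Local Open Scope classical_set_scope.
Local Open Scope ring_scope.

Section Euclidean.
Context {R : realType} {n : nat}.
Implicit Types u v : 'rV[R]_n.

(* The norm `|u| that the library puts on 'rV[R]_n is the sup norm. *)
Definition euclid_norm u : R := Num.sqrt (\sum_(i < n) u 0 i ^+ 2).

Definition euclid_dist u v : R := euclid_norm (u - v).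

End Euclidean.

Section Minimum.
Context {R : realType}.

Definition is_min (S : set R) (m : R) : Prop := S m /\ lbound S m.

End Minimum.

Section Geodesics.
Context {R : realType} {X : metricType R}.
Implicit Types x y z : X.

(* A geodesic defined on [0, l] is represented by a function on all of R,
   whose values outside of [0, l] are irrelevant. *)
Definition isometric_on (l : R) (g : R -> X) : Prop :=
  {in `[0, l] &, forall s t, mdist (g s) (g t) = `|s - t|}.

Definition is_segment x y (g : R -> X) : Prop :=
  [/\ g 0 = x, g (mdist x y) = y & isometric_on (mdist x y) g].

(* The points p = g (s * mdist x y) of [x, y] and q = h (t * mdist x z) of
   [x, z] are at most as far apart as their comparison points in the Euclidean
   plane. Since x, y and z are arbitrary, this covers every pair of sides of a
   geodesic triangle; if p and q are on the same side, nothing is to check. *)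
Definition cat0_inequality : Prop :=
  forall x y z (g h : R -> X), is_segment x y g -> is_segment x z h ->
  forall x' y' z' : 'rV[R]_2,
    euclid_dist x' y' = mdist x y -> euclid_dist y' z' = mdist y z ->
    euclid_dist x' z' = mdist x z ->
  forall s t : R, 0 <= s <= 1 -> 0 <= t <= 1 ->
    mdist (g (s * mdist x y)) (h (t * mdist x z)) <=
    euclid_dist ((1 - s) *: x' + s *: y') ((1 - t) *: x' + t *: z').

End Geodesics.

HB.mixin Record Metric_isCAT0 (R : realType) X & Metric R X := {
  segment_ex : forall x y : X, exists g : R -> X, is_segment x y g;
  cat0P : @cat0_inequality R X
}.

#[short(type="hadamardType")]
HB.structure Definition Hadamard (R : realType) :=
  {X of Metric R X & Complete X & Metric_isCAT0 R X}.

Section AlexandrovAngle.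
Context {R : realType} {X : metricType R}.

(* The angle at the vertex corresponding to x of a Euclidean triangle with the
   side lengths of x, p, q, by the law of cosines. *)
Definition comparison_angle (x p q : X) : R :=
  acos ((mdist x p ^+ 2 + mdist x q ^+ 2 - mdist p q ^+ 2) /
        (2 * mdist x p * mdist x q)).

(* The limit superior, as s and t tend to 0 from the right, of the comparison
   angle at x = g 0 = h 0 between g s and h t. *)
Definition alexandrov_angle (g h : R -> X) : R :=
  fine (limf_esup
    (fun p : R * R => (comparison_angle (g 0) (g p.1) (h p.2))%:E)
    (filter_prod (0 : R)^'+ (0 : R)^'+)).

End AlexandrovAngle.

Section TangentCone.
Context {R : realType} {X : metricType R} (x : X).

Record geodesic_from := GeodesicFrom {
  geo_length : R;
  geo_fun :> R -> X;
  geo_length_gt0 : 0 < geo_length;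
  geo_fun0 : geo_fun 0 = x;
  geo_funP : isometric_on geo_length geo_fun
}.

Definition direction_class (g : geodesic_from) : set geodesic_from :=
  [set h : geodesic_from | alexandrov_angle g h = 0].

Definition direction : Type :=
  {D : set geodesic_from | exists g, D = direction_class g}.

Definition direction_of (g : geodesic_from) : direction :=
  exist _ (direction_class g) (ex_intro _ g erefl).

Definition direction_repr (D : direction) : geodesic_from :=
  sval (cid (proj2_sig D)).

(* The Alexandrov angle satisfies the triangle inequality, hence the choice of
   representatives does not matter. *)
Definition direction_angle (D E : direction) : R :=
  alexandrov_angle (direction_repr D) (direction_repr E).

(* Cone over the space of directions: cone_apex is the point to which all pairs
   (D, 0) are identified, cone_point D r0 with r0 : 0 < r is the pair (D, r). *)
Inductive tangent_cone : Type :=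
| cone_apex
| cone_point (D : direction) (r : R) of 0 < r.

Definition cone_norm (u : tangent_cone) : R :=
  if u is @cone_point _ r _ then r else 0.

Definition cone_dot (u v : tangent_cone) : R :=
  match u, v with
  | @cone_point D r _, @cone_point E s _ => r * s * cos (direction_angle D E)
  | _, _ => 0
  end.

Definition cone_dist (u v : tangent_cone) : R :=
  Num.sqrt (cone_norm u ^+ 2 + cone_norm v ^+ 2 - 2 * cone_dot u v).

Definition cone_isometry (n : nat) (phi : tangent_cone -> 'rV[R]_n) : Prop :=
  bijective phi /\ forall u v, euclid_dist (phi u) (phi v) = cone_dist u v.

End TangentCone.

Arguments cone_apex {R X x}.

Section HadamardSpace.
Context {R : realType} {X : hadamardType R}.
Implicit Types x y a : X.

(* In a Hadamard space segments are unique, as functions on [0, mdist x y]. *)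
Definition segment x y : R -> X := sval (cid (segment_ex x y)).

Lemma segmentP x y : is_segment x y (segment x y).
Proof. exact: (svalP (cid (segment_ex x y))). Qed.

Definition angle a x y : R := alexandrov_angle (segment x a) (segment x y).

Lemma mdist_neq_gt0 x a : a != x -> 0 < mdist a x.
Proof. by rewrite mdist_gt0. Qed.

Lemma segment_length_gt0 x a : a != x -> 0 < mdist x a.
Proof. by rewrite mdist_gt0 eq_sym. Qed.

Lemma segment0 x a : segment x a 0 = x.
Proof. by case: (segmentP x a). Qed.

Lemma segment_isometric x a : isometric_on (mdist x a) (segment x a).
Proof. by case: (segmentP x a). Qed.

Definition geodesic_to x a (ax : a != x) : geodesic_from x :=
  GeodesicFrom (segment_length_gt0 ax) (segment0 x a) (@segment_isometric x a).

(* The vector ([ [x, a] ], mdist a x), which is the apex if a = x. *)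
Definition tangent_vector x a : tangent_cone x :=
  match pselect (a != x) with
  | left ax => cone_point (direction_of (geodesic_to ax)) (mdist_neq_gt0 ax)
  | right _ => cone_apex
  end.

(* If A is nonempty and x is not in A, then the set of which the supremum is
   taken is nonempty and bounded above. *)
Definition mean_deficit (A : {fset X}) x : R :=
  Num.max (sup [set m : R | exists2 y, y != x &
    is_min [set mdist a x * cos (angle a x y) | a in [set` A]] m]) 0.

End HadamardSpace.

(* Main.v *)
(* By the CAT(0) inequality, the comparison angle between two geodesics issuing
   from x decreases as their parameters tend to 0. Hence the chord quotient
   d(g(t), h(t)) / t converges to 2 sin(theta / 2), where theta is the Alexandrov
   angle, which makes theta independent of the representatives of the
   directions. An isometry from the tangent cone to Euclidean space fixing the
   origin turns d(a, x) cos(angle a x y) into the inner product of v_a with the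
   unit vector u pointing to y. For every convex combination p of the v_a, the
   minimum over a of <v_a, u> is at most <p, u> <= |p|. If p is the shortest
   one and p <> 0, then p is the cone point of a geodesic issuing from x; taking
   for y its endpoint, <v_a, p> >= |p|^2 for all a gives equality. *)
Require Import Defs.
From HB Require Import structures.
From mathcomp Require Import all_boot all_order all_algebra finmap.
From mathcomp Require Import all_classical all_reals all_analysis.
From mathcomp Require Import ring lra.

Set Implicit Arguments.
Unset Strict Implicit.
Unset Printing Implicit Defensive.

Import Order.TTheory GRing.Theory Num.Theory.
Import numFieldNormedType.Exports.

Local Open Scope classical_set_scope.
Local Open Scope ring_scope.

(** * Inner products and shortest convex combinations in Euclidean space *)

Section EuclideanGeometry.
Context {R : realType} {n : nat}.
Implicit Types u v w : 'rV[R]_n.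

Definition euclid_dot u v : R := \sum_(i < n) u 0 i * v 0 i.

Lemma euclid_dotC u v : euclid_dot u v = euclid_dot v u.
Proof. by apply: eq_bigr => i _; rewrite mulrC. Qed.

Lemma euclid_dotDl u v w :
  euclid_dot (u + v) w = euclid_dot u w + euclid_dot v w.
Proof. by rewrite -big_split; apply: eq_bigr => i _; rewrite mxE mulrDl. Qed.

Lemma euclid_dotZl c u v : euclid_dot (c *: u) v = c * euclid_dot u v.
Proof. by rewrite mulr_sumr; apply: eq_bigr => i _; rewrite mxE mulrA. Qed.

Lemma euclid_dot_suml (I : finType) (c : I -> R) (p : I -> 'rV[R]_n) v :
  euclid_dot (\sum_i c i *: p i) v = \sum_i c i * euclid_dot (p i) v.
Proof.
rewrite /euclid_dot; under [RHS]eq_bigr do rewrite mulr_sumr.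
rewrite exchange_big; apply: eq_bigr => j _.
by rewrite summxE mulr_suml; apply: eq_bigr => i _; rewrite mxE mulrA.
Qed.

Lemma sqr_euclid_norm u : euclid_norm u ^+ 2 = euclid_dot u u.
Proof.
rewrite sqr_sqrtr; last by apply: sumr_ge0 => i _; rewrite sqr_ge0.
by apply: eq_bigr => i _; rewrite expr2.
Qed.

Lemma euclid_norm_ge0 u : 0 <= euclid_norm u.
Proof. exact: sqrtr_ge0. Qed.

Lemma sqr_euclid_normD c u v : euclid_norm (u + c *: v) ^+ 2 =
  euclid_norm u ^+ 2 + 2 * c * euclid_dot u v + c ^+ 2 * euclid_norm v ^+ 2.
Proof.
rewrite !sqr_euclid_norm !(euclid_dotDl, euclid_dotZl).
rewrite ![euclid_dot _ (_ + _)]euclid_dotC !(euclid_dotDl, euclid_dotZl).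
rewrite (euclid_dotC v u); ring.
Qed.

(** The Cauchy-Schwarz inequality for a unit vector: the component of [u] orthogonal to [v] has
    nonnegative squared norm. *)
Lemma euclid_dot_le_norm u v : euclid_norm v = 1 ->
  euclid_dot u v <= euclid_norm u.
Proof.
move=> v1; have := sqr_ge0 (euclid_norm (u + (- euclid_dot u v) *: v)).
rewrite sqr_euclid_normD v1; have := euclid_norm_ge0 u; nra.
Qed.

(** The norm depends continuously on the weights, which range over a compact simplex. The weights
    are encoded as row vectors so that the extreme value theorem applies. *)
Lemma shortest_convex_combination (I : finType) (i0 : I) (p : I -> 'rV[R]_n) :
  exists c : I -> R, [/\ forall i, 0 <= c i, \sum_i c i = 1 &
    forall d : I -> R, (forall i, 0 <= d i) -> \sum_i d i = 1 ->
      euclid_norm (\sum_i c i *: p i) <= euclid_norm (\sum_i d i *: p i)].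
Proof.
pose weight (c : 'rV[R]_#|I|) i := c 0 (enum_rank i).
pose total (c : 'rV[R]_#|I|) := \sum_i weight c i.
pose f (c : 'rV[R]_#|I|) := euclid_norm (\sum_i weight c i *: p i).
pose K : set 'rV[R]_#|I| :=
  [set c : 'rV[R]_#|I| | forall k, c 0 k \in `[0, 1]] `&` total @^-1` [set 1].
have cw i : continuous (weight^~ i) by move=> c; apply: coord_continuous.
have addc : continuous (fun x : R * R => x.1 + x.2).
  by move=> x; exact: add_continuous.
have ctotal : continuous total by exact: (continuous_big addc).
have cf : continuous f.
  move=> c; apply: (continuous_comp (g := @Num.sqrt R)); last first.
    exact: sqrt_continuous.
  move: c; apply: (continuous_big addc) => j _.
  pose g (c : 'rV[R]_#|I|) := \sum_i weight c i * p i 0 j.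
  have cg : continuous g.
    by apply: (continuous_big addc) => i _ c; exact: (cvgMr_tmp (cw i c)).
  have -> : (fun c => (\sum_i weight c i *: p i) 0 j ^+ 2) =
      (fun x => x ^+ 2) \o g.
    by apply/funext => c /=; rewrite summxE; under eq_bigr do rewrite mxE.
  by move=> c; apply: continuous_comp; [exact: cg | exact: exprn_continuous].
have Kc : compact K.
  apply: compact_closedI; last first.
    by apply: preimage_closed => // c _; apply: ctotal.
  exact: (rV_compact (fun=> @segment_compact R 0 1)).
have KE d : (forall i, 0 <= d i) -> \sum_i d i = 1 ->
    exists2 c, K c & forall i, weight c i = d i.
  move=> d0 d1; exists (\row_k d (enum_val k)).
    split=> [k|] /=; last first.
      by rewrite -d1; apply: eq_bigr => i _; rewrite /weight mxE enum_rankK.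
    rewrite mxE in_itv /= d0 -d1 (bigD1 (enum_val k)) //= lerDl.
    exact: sumr_ge0.
  by move=> i; rewrite /weight mxE enum_rankK.
(* The vertex of the simplex with all weight on [i0]. *)
have K0 : K !=set0.
  have [||c Kc0 _] := KE (fun i => (i == i0)%:R).
  - by move=> i; rewrite ler0n.
  - by rewrite (bigD1 i0) //= eqxx big1 ?addr0 // => i /negPf ->.
  by exists c.
have [c /set_mem [c01 c1] cmin] := EVT_min_rV K0 Kc (continuous_subspaceT cf).
exists (weight c); split=> [i||d d0 d1] //.
  by have := c01 (enum_rank i); rewrite in_itv => /andP[].
have [e Ke eE] := KE d d0 d1.
have := cmin e (mem_set Ke); rewrite {2}/f.
by under eq_bigr do rewrite eE.
Qed.

(** The first-order condition at the minimum: moving from the shortest combination [q] towards [p i]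
    stays among the convex combinations, so the norm cannot decrease to first order. *)
Lemma shortest_convex_combination_dot (I : finType) (p : I -> 'rV[R]_n)
    (c : I -> R) (i : I) :
  (forall i, 0 <= c i) -> \sum_i c i = 1 ->
  (forall d : I -> R, (forall i, 0 <= d i) -> \sum_i d i = 1 ->
    euclid_norm (\sum_i c i *: p i) <= euclid_norm (\sum_i d i *: p i)) ->
  euclid_norm (\sum_i c i *: p i) ^+ 2 <=
  euclid_dot (p i) (\sum_i c i *: p i).
Proof.
move=> c0 c1 cmin; set q := \sum_i _ in cmin *.
pose D := euclid_norm (p i - q) ^+ 2.
(* Expand the squared norm of [q + t *: (p i - q)], subtract that of [q] and divide by [t]. *)
have small t : 0 < t <= 1 -> 0 <= 2 * euclid_dot q (p i - q) + t * D.
  move=> /andP[t0 t1].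
  pose d j := (1 - t) * c j + t * (j == i)%:R.
  (* Stated for any module, since it serves both for the vectors [p] and, with all values 1, for the
     total weight. *)
  have dE (V : lmodType R) (v : I -> V) :
      \sum_j d j *: v j = (1 - t) *: (\sum_j c j *: v j) + t *: v i.
    under eq_bigr do rewrite scalerDl -!scalerA.
    rewrite big_split /= -!scaler_sumr; congr (_ + _ *: _).
    rewrite (bigD1 i) //= eqxx scale1r.
    by rewrite big1 ?addr0 // => j /negPf ->; rewrite scale0r.
  have dq : \sum_j d j *: p j = q + t *: (p i - q).
    by rewrite dE -/q scalerBl scale1r scalerBr addrAC addrA.
  have d0 j : 0 <= d j.
    by rewrite addr_ge0 // mulr_ge0 ?ler0n ?subr_ge0 // ltW.
  have d1 : \sum_j d j = 1.
    have := dE R^o (fun=> 1).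
    under eq_bigr do rewrite /GRing.scale /= mulr1.
    move=> ->; under eq_bigr do rewrite /GRing.scale /= mulr1.
    by rewrite c1 /GRing.scale /=; ring.
  have := cmin d d0 d1; rewrite dq.
  rewrite -(@ler_sqr _ (euclid_norm q)) ?nnegrE ?euclid_norm_ge0 //.
  rewrite sqr_euclid_normD -/D => h.
  rewrite -(pmulr_rge0 _ t0); nra.
have Dge0 : 0 <= D by exact: sqr_ge0.
have : 0 <= euclid_dot q (p i - q).
  rewrite leNgt; apply/negP => neg.
  (* With [t = e / (D + e)] the quadratic term satisfies [t * D <= e], too little to compensate
     [- 2 * e]. *)
  pose e := - euclid_dot q (p i - q).
  have e0 : 0 < e by rewrite oppr_gt0.
  have De : 0 < D + e by rewrite ltr_wpDl.
  have /small : 0 < e / (D + e) <= 1.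
    by rewrite divr_gt0 //= ler_pdivrMr // mul1r lerDr.
  have : e / (D + e) * D <= e.
    by rewrite mulrAC ler_pdivrMr // ler_pM2l // lerDl ltW.
  rewrite /e in e0 *; lra.
rewrite sqr_euclid_norm euclid_dotC euclid_dotDl.
rewrite -[- q]scaleN1r euclid_dotZl; lra.
Qed.

End EuclideanGeometry.

(** * The law of cosines in CAT(0) spaces, with preliminaries *)

Lemma isometric_onW (R : realType) (X : metricType R) (l l' : R) (g : R -> X) :
  l' <= l -> isometric_on l g -> isometric_on l' g.
Proof.
move=> ll' gl s t; rewrite !in_itv /= => /andP[s0 sl] /andP[t0 tl].
by apply: gl; rewrite in_itv /= ?s0 ?t0 (le_trans _ ll').
Qed.

Lemma acos_anti (R : realType) (a b : R) :
  -1 <= a <= 1 -> -1 <= b <= 1 -> a <= b -> acos b <= acos a.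
Proof.
move=> a1 b1 ab; rewrite leNgt -ltr_cos ?in_itv /= ?acos_ge0 ?acos_lepi //.
by rewrite !acosK ?in_itv // -leNgt.
Qed.

Lemma euclid_norm_rV2 (R : realType) (v : 'rV[R]_2) :
  euclid_norm v = Num.sqrt (v 0 0 ^+ 2 + v 0 1 ^+ 2).
Proof.
rewrite /euclid_norm !big_ord_recl big_ord0 addr0.
by congr (Num.sqrt (_ + v _ _ ^+ 2)); apply/val_inj.
Qed.

Section CAT0Angle.
Context {R : realType} {X : hadamardType R}.

Lemma is_segment_isometric (x : X) (g : R -> X) (s : R) :
  0 <= s -> g 0 = x -> isometric_on s g ->
  mdist x (g s) = s /\ is_segment x (g s) g.
Proof.
move=> s0 g0 gs.
have gsE : mdist x (g s) = s.
  by rewrite -g0 gs ?in_itv /= ?lexx ?s0 // sub0r normrN ger0_norm.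
by split; rewrite // /is_segment gsE.
Qed.

(** The right-hand side is the squared distance of the comparison points, computed in an explicit
    comparison triangle in the plane. *)
Lemma cat0_law_of_cosines (x : X) (g h : R -> X) (s t a b : R) :
  g 0 = x -> h 0 = x -> isometric_on s g -> isometric_on t h ->
  0 < s -> 0 < t -> 0 <= a <= 1 -> 0 <= b <= 1 ->
  mdist (g (a * s)) (h (b * t)) ^+ 2 <=
  (a * s) ^+ 2 + (b * t) ^+ 2
    - a * b * (s ^+ 2 + t ^+ 2 - mdist (g s) (h t) ^+ 2).
Proof.
move=> g0 h0 gs ht s0 t0 a01 b01.
have [gsE gseg] := is_segment_isometric (ltW s0) g0 gs.
have [htE hseg] := is_segment_isometric (ltW t0) h0 ht.
set D := mdist (g s) (h t).
have D1 : D <= s + t.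
  by have := metric_triangle (g s) x (h t); rewrite (metric_sym _ x) gsE htE.
have D2 : s <= t + D.
  by have := metric_triangle x (h t) (g s); rewrite (metric_sym (h t)) gsE htE.
have D3 : t <= s + D.
  by have := metric_triangle x (g s) (h t); rewrite gsE htE.
have Dge0 : 0 <= D by exact: mdist_ge0.
(* The comparison triangle has the vertices [0], [(s, 0)] and [(u, w)]. The law of cosines dictates
   [u]; the triangle inequalities give [u ^+ 2 <= t ^+ 2], so that [w] can complete the length
   [t]. *)
pose u := (s ^+ 2 + t ^+ 2 - D ^+ 2) / (2 * s).
have uE : 2 * s * u = s ^+ 2 + t ^+ 2 - D ^+ 2.
  by rewrite /u mulrC divfK // mulf_neq0 ?pnatr_eq0 ?gt_eqF.
have ut : u ^+ 2 <= t ^+ 2.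
  have : `|2 * s * u| <= 2 * s * t.
    by rewrite ler_norml uE; apply/andP; split; nra.
  rewrite normrM gtr0_norm ?mulr_gt0 // ler_pM2l ?mulr_gt0 // => ut.
  by rewrite -real_normK ?num_real // ler_sqr ?nnegrE // ltW.
pose w := Num.sqrt (t ^+ 2 - u ^+ 2).
have wE : w ^+ 2 = t ^+ 2 - u ^+ 2 by rewrite sqr_sqrtr ?subr_ge0.
pose y' : 'rV[R]_2 := \row_j [:: s; 0]`_j.
pose z' : 'rV[R]_2 := \row_j [:: u; w]`_j.
have := @cat0P R X _ _ _ _ _ gseg hseg 0 y' z' _ _ _ a b a01 b01.
rewrite gsE htE /euclid_dist !euclid_norm_rV2 /y' /z' !mxE /= => cat0.
have sqrtE (r c : R) : 0 <= c -> r = c ^+ 2 -> Num.sqrt r = c.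
  by move=> c0 ->; rewrite sqrtr_sqr ger0_norm.
rewrite -/D in cat0; clearbody D w u.
have {cat0} := cat0 (sqrtE _ _ (ltW s0) _) (sqrtE _ _ Dge0 _)
  (sqrtE _ _ (ltW t0) _).
have e1 : (0 - s) ^+ 2 + (0 - 0) ^+ 2 = s ^+ 2 by ring.
have e2 : (s - u) ^+ 2 + (0 - w) ^+ 2 = D ^+ 2 by rewrite sub0r sqrrN wE; lra.
have e3 : (0 - u) ^+ 2 + (0 - w) ^+ 2 = t ^+ 2.
  by rewrite !sub0r !sqrrN wE; ring.
move=> /(_ e1 e2 e3).
set E := _ + _ => le.
have E0 : 0 <= E by rewrite addr_ge0 // sqr_ge0.
have : mdist (g (a * s)) (h (b * t)) ^+ 2 <= E.
  by rewrite -(sqr_sqrtr E0) ler_sqr ?nnegrE ?mdist_ge0 ?sqrtr_ge0.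
move=> /le_trans; apply; rewrite /E le_eqVlt; apply/orP; left; apply/eqP.
rewrite -uE.
transitivity (a ^+ 2 * s ^+ 2 - 2 * a * b * s * u + b ^+ 2 * (u ^+ 2 + w ^+ 2)).
  ring.
by rewrite wE; ring.
Qed.

(** * Alexandrov angles between geodesics issuing from a point *)

Section Angle.
Context {x : X}.
Implicit Types g h k : geodesic_from x.

Definition common_length g h : R := Num.min (geo_length g) (geo_length h).

Lemma common_length_gt0 g h : 0 < common_length g h.
Proof. by rewrite lt_min !geo_length_gt0. Qed.

Lemma le_common_length g h t : 0 < t <= common_length g h ->
  0 < t <= geo_length g /\ 0 < t <= geo_length h.
Proof. by rewrite le_min => /and3P[-> -> ->]. Qed.

(** The cosine of the comparison angle at [x] between [g s] and [h t], as long as [s] and [t] are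
    positive and at most the lengths of the geodesics. *)
Definition chord_cos g h (s t : R) : R :=
  (s ^+ 2 + t ^+ 2 - mdist (g s) (h t) ^+ 2) / (2 * s * t).

Lemma geo_dist g s : 0 <= s <= geo_length g -> mdist x (g s) = s.
Proof.
move=> /andP[s0 sl].
by case: (is_segment_isometric s0 (geo_fun0 g)
  (isometric_onW sl (@geo_funP _ _ _ g))).
Qed.

Lemma chord_cos_bound g h s t :
  0 < s <= geo_length g -> 0 < t <= geo_length h ->
  -1 <= chord_cos g h s t <= 1.
Proof.
move=> /andP[s0 sl] /andP[t0 tl].
have gs : mdist x (g s) = s by rewrite geo_dist // sl ltW.
have ht : mdist x (h t) = t by rewrite geo_dist // tl ltW.
have D1 := metric_triangle (g s) x (h t).
have D2 := metric_triangle x (h t) (g s).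
have D3 := metric_triangle x (g s) (h t).
have D0 := mdist_ge0 (g s) (h t).
rewrite (metric_sym (g s) x) gs ht in D1.
rewrite (metric_sym (h t) (g s)) gs ht in D2.
rewrite gs ht in D3.
rewrite /chord_cos ler_pdivlMr ?ler_pdivrMr ?mulr_gt0 //.
by apply/andP; split; nra.
Qed.

Lemma comparison_angleE g h s t :
  0 < s <= geo_length g -> 0 < t <= geo_length h ->
  comparison_angle (g 0) (g s) (h t) = acos (chord_cos g h s t).
Proof.
move=> /andP[s0 sl] /andP[t0 tl].
by rewrite /comparison_angle geo_fun0 !geo_dist // ?sl ?tl ltW.
Qed.

(** Comparison angles shrink as the points approach [x]: this is the CAT(0) law of cosines divided
    by [2 * (a * s) * (b * t)]. *)
Lemma chord_cos_anti g h s t a b :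
  0 < s <= geo_length g -> 0 < t <= geo_length h ->
  0 < a <= 1 -> 0 < b <= 1 ->
  chord_cos g h s t <= chord_cos g h (a * s) (b * t).
Proof.
move=> /andP[s0 sl] /andP[t0 tl] /andP[a0 a1] /andP[b0 b1].
have := @cat0_law_of_cosines x g h s t a b (geo_fun0 g) (geo_fun0 h)
  (isometric_onW sl (@geo_funP _ _ _ g))
  (isometric_onW tl (@geo_funP _ _ _ h)) s0 t0.
rewrite a1 b1 (ltW a0) (ltW b0) => /(_ isT isT) le.
rewrite /chord_cos ler_pdivrMr ?mulr_gt0 // mulrAC ler_pdivlMr ?mulr_gt0 //.
have st : 0 < 2 * s * t by rewrite !mulr_gt0.
nra.
Qed.

Lemma chord_cos_diag g h t : 0 < t ->
  chord_cos g h t t = 1 - (mdist (g t) (h t) / t) ^+ 2 / 2.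
Proof. by move=> t0; rewrite /chord_cos; field; rewrite gt_eqF. Qed.

(** By monotonicity the limit superior over pairs [(s, t)] is the infimum of the comparison angles
    on the diagonal. *)
Lemma alexandrov_angle_spec g h (theta := alexandrov_angle g h) :
  [/\ 0 <= theta <= pi,
    forall t, 0 < t <= common_length g h -> theta <= acos (chord_cos g h t t) &
    forall psi, (forall t, 0 < t <= common_length g h ->
      psi <= acos (chord_cos g h t t)) -> psi <= theta].
Proof.
have l0 := common_length_gt0 g h.
rewrite /theta /alexandrov_angle; set L := limf_esup _ _.
have upper t : 0 < t <= common_length g h ->
    (L <= (acos (chord_cos g h t t))%:E)%E.
  move=> tl; have [tg th] := le_common_length tl; have /andP[t0 _] := tl.
  (* On this square the comparison angle is largest at the corner [(t, t)]. *)
  pose V : set (R * R) := [set r : R | 0 < r <= t] `*` [set r : R | 0 < r <= t].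
  apply: (@le_trans _ _ (ereal_sup
      [set (comparison_angle (g 0) (g p.1) (h p.2))%:E | p in V])).
    apply: ereal_inf_lbound; exists V => //.
    have near0 : (0 : R)^'+ [set r : R | 0 < r <= t].
      near=> r => /=; apply/andP; split; near: r.
        exact: nbhs_right_gt.
      exact: nbhs_right_le.
    by exists ([set r : R | 0 < r <= t], [set r : R | 0 < r <= t]).
  apply: ge_ereal_sup => _ [[r s] [/= /andP[r0 rt] /andP[s0 st]] <-].
  have rg : 0 < r <= geo_length g by rewrite r0 (le_trans rt) //; case/andP: tg.
  have sh : 0 < s <= geo_length h by rewrite s0 (le_trans st) //; case/andP: th.
  rewrite comparison_angleE // lee_fin.
  apply: acos_anti; try exact: chord_cos_bound.
  rewrite -[r](divfK (lt0r_neq0 t0)) -[s](divfK (lt0r_neq0 t0)).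
  by apply: chord_cos_anti; rewrite ?divr_gt0 ?ler_pdivrMr ?mul1r.
have lower psi : (forall t, 0 < t <= common_length g h ->
    psi <= acos (chord_cos g h t t)) -> (psi%:E <= L)%E.
  move=> hpsi; apply: le_ereal_inf_tmp => _ [V [[P Q] [/= P0 Q0] PQV] <-].
  (* Every member of the product filter contains a diagonal point, where the bound [psi] applies. *)
  have [t /= [[[Pt Qt] t0] tl]] : exists t,
      ((P t /\ Q t) /\ 0 < t) /\ t <= common_length g h.
    apply: (@filter_ex _ ((0 : R)^'+)).
    near=> r; split; last by near: r; exact: nbhs_right_le.
    by split; [split; near: r|near: r; exact: nbhs_right_gt].
  have tgh : 0 < t <= common_length g h by rewrite t0.
  have [tg th] := le_common_length tgh.
  apply: (@le_trans _ _ (comparison_angle (g 0) (g t) (h t))%:E).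
    by rewrite comparison_angleE // lee_fin hpsi.
  by apply: ereal_sup_ubound; exists (t, t) => //; exact: PQV.
have lgh : 0 < common_length g h <= common_length g h by rewrite l0 lexx.
have bound t : 0 < t <= common_length g h -> -1 <= chord_cos g h t t <= 1.
  by move=> /le_common_length[]; exact: chord_cos_bound.
have L0 : (0%:E <= L)%E by apply: lower => t /bound; exact: acos_ge0.
have Lpi : (L <= pi%:E)%E.
  by apply: (le_trans (upper _ lgh)); rewrite lee_fin acos_lepi // bound.
(* Lying between 0 and [pi], [L] is finite, so [fine] does not return its default value. *)
have LE : L = (fine L)%:E.
  by rewrite fineK // fin_numElt (lt_le_trans _ L0)
    ?(le_lt_trans Lpi) ?ltry ?ltNyr.
split=> [|t tl|psi hpsi].
- by rewrite -!lee_fin -LE L0.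
- by rewrite -lee_fin -LE; exact: upper.
- by rewrite -lee_fin -LE; exact: lower.
Unshelve. all: by end_near. Qed.

(* The limit of the chord quotient is 2 sin (theta / 2). *)
Lemma chord_quotient_cvg g h : mdist (g t) (h t) / t @[t --> 0^'+] -->
  Num.sqrt (2 * (1 - cos (alexandrov_angle g h))).
Proof.
have [] := alexandrov_angle_spec g h; set theta := alexandrov_angle g h.
move=> theta0pi le_theta theta_max; set K := Num.sqrt _.
have KE : K ^+ 2 = 2 * (1 - cos theta).
  by rewrite sqr_sqrtr // mulr_ge0 // subr_ge0 cos_le1.
have K0 : 0 <= K by exact: sqrtr_ge0.
have l0 := common_length_gt0 g h.
have bound t : 0 < t <= common_length g h -> -1 <= chord_cos g h t t <= 1.
  by move=> /le_common_length[]; exact: chord_cos_bound.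
pose q t := mdist (g t) (h t) / t.
have q0 t : 0 < t -> 0 <= q t.
  by move=> t0; rewrite divr_ge0 ?mdist_ge0 // ltW.
have Kq t : 0 < t <= common_length g h -> K <= q t.
  move=> tl; have /andP[t0 _] := tl.
  rewrite -ler_sqr ?nnegrE ?q0 // KE.
  have : chord_cos g h t t <= cos theta.
    rewrite -[X in X <= _](@acosK R) ?in_itv ?bound //.
    rewrite leNgt ltr_cos ?in_itv //= ?acos_ge0 ?acos_lepi ?bound //.
    by rewrite -leNgt le_theta.
  rewrite chord_cos_diag // -/(q t); lra.
have qmono s t : 0 < s <= t -> t <= common_length g h -> q s <= q t.
  move=> /andP[s0 st] tl; have t0 := lt_le_trans s0 st.
  have [tg th] : 0 < t <= geo_length g /\ 0 < t <= geo_length h.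
    by apply: le_common_length; rewrite t0.
  have := @chord_cos_anti g h t t (s / t) (s / t) tg th.
  rewrite divr_gt0 // ler_pdivrMr // mul1r st => /(_ isT isT).
  rewrite divfK ?gt_eqF // !chord_cos_diag // -/(q s) -/(q t).
  by rewrite -(@ler_sqr _ (q s)) ?nnegrE ?q0 //; lra.
apply/cvgrPdist_lt => e e0.
(* Otherwise [acos M], the angle belonging to the chord quotient [K + e], is below all diagonal
   comparison angles, hence at most [theta]; this contradicts [0 < e]. Monotonicity of [q] then
   carries the bound to all smaller parameters. *)
have [t [tl qt]] : exists t, 0 < t <= common_length g h /\ q t < K + e.
  apply: contrapT => no_t.
  have Kq' t : 0 < t <= common_length g h -> K + e <= q t.
    by move=> tl; rewrite leNgt; apply/negP => qt; apply: no_t; exists t.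
  pose M := 1 - (K + e) ^+ 2 / 2.
  have cM t : 0 < t <= common_length g h -> chord_cos g h t t <= M.
    move=> tl; have /andP[t0 _] := tl.
    have : (K + e) ^+ 2 <= q t ^+ 2.
      by rewrite ler_sqr ?nnegrE ?q0 ?Kq' // addr_ge0 // ltW.
    rewrite chord_cos_diag // -/(q t) /M; lra.
  have M1 : -1 <= M <= 1.
    have ll : 0 < common_length g h <= common_length g h by rewrite l0 lexx.
    have /andP[c1 _] := bound _ ll; rewrite (le_trans c1) ?cM //=.
    by have := sqr_ge0 (K + e); rewrite /M; lra.
  have : acos M <= theta.
    by apply: theta_max => t tl; apply: acos_anti; rewrite ?bound ?cM.
  rewrite leNgt -ltr_cos ?in_itv /= ?acos_ge0 ?acos_lepi // acosK ?in_itv //.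
  by rewrite -leNgt /M; nra.
have /andP[t0 tl'] := tl.
near=> s.
have s0 : 0 < s by near: s; exact: nbhs_right_gt.
have st : s <= t by near: s; exact: nbhs_right_le.
have := qmono s t; rewrite s0 st => /(_ isT tl') qst.
have := Kq s; rewrite s0 (le_trans st) // => /(_ isT) Ks.
rewrite -/(q s) distrC ger0_norm ?subr_ge0 //; lra.
Unshelve. all: by end_near. Qed.

(** Limits are unique and the cosine is injective on [[0, pi]], so an angle can be read off from the
    limit of the chord quotient. *)
Lemma alexandrov_angle_cvg g h theta : 0 <= theta <= pi ->
  mdist (g t) (h t) / t @[t --> 0^'+] --> Num.sqrt (2 * (1 - cos theta)) ->
  alexandrov_angle g h = theta.
Proof.
move=> theta0pi hk.
have /eqP : Num.sqrt (2 * (1 - cos (alexandrov_angle g h))) =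
    Num.sqrt (2 * (1 - cos theta)).
  by apply: (cvg_unique _ (@chord_quotient_cvg g h) hk); exact: Rhausdorff.
rewrite eqr_sqrt ?mulr_ge0 ?subr_ge0 ?cos_le1 // => /eqP eq_cos.
apply: cos_inj; rewrite ?in_itv //=; last by lra.
by case: (alexandrov_angle_spec g h).
Qed.

Lemma alexandrov_angle_itv g h : 0 <= alexandrov_angle g h <= pi.
Proof. by case: (alexandrov_angle_spec g h). Qed.

Lemma alexandrov_angleC g h : alexandrov_angle g h = alexandrov_angle h g.
Proof.
apply: alexandrov_angle_cvg; first exact: alexandrov_angle_itv.
have := @chord_quotient_cvg h g.
by under eq_fun do rewrite metric_sym.
Qed.

Lemma alexandrov_angle_eq0 g h c : 0 < c ->
  (forall t, 0 <= t <= c -> g t = h t) -> alexandrov_angle g h = 0.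
Proof.
move=> c0 gh; apply: alexandrov_angle_cvg; first by rewrite lexx pi_ge0.
rewrite cos0 subrr mulr0 sqrtr0.
apply: (@cvg_trans _ ((fun=> 0) @ 0^'+)); last exact: cvg_cst.
apply: near_eq_cvg; near=> t; rewrite gh ?mdistxx ?mul0r //.
by apply/andP; split; [apply: ltW; near: t; exact: nbhs_right_gt
  | near: t; exact: nbhs_right_le].
Unshelve. all: by end_near. Qed.

Lemma alexandrov_anglexx g : alexandrov_angle g g = 0.
Proof. exact: (@alexandrov_angle_eq0 g g 1). Qed.

(** By the triangle inequality in [X], the chord quotients of [g, h] and of [g', h] differ by at
    most that of [g, g'], which tends to 0. *)
Lemma alexandrov_angle_congl g g' h :
  alexandrov_angle g g' = 0 -> alexandrov_angle g h = alexandrov_angle g' h.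
Proof.
move=> gg'; apply: alexandrov_angle_cvg; first exact: alexandrov_angle_itv.
have cgh := @chord_quotient_cvg g' h.
have := @chord_quotient_cvg g g'; rewrite gg' cos0 subrr mulr0 sqrtr0 => cgg'.
rewrite -[Num.sqrt _]addr0.
pose q (a b : geodesic_from x) t := mdist (a t) (b t) / t.
have diff0 : q g h t - q g' h t @[t --> 0^'+] --> 0.
  apply: norm_cvg0; apply: (squeeze_cvgr _ (cvg_cst 0) cgg').
  near=> t; have t0 : 0 < t by near: t; exact: nbhs_right_gt.
  rewrite normr_ge0 /= -mulrBl normrM normfV (gtr0_norm t0).
  rewrite ler_pM2r ?invr_gt0 // ler_norml.
  have := metric_triangle (g t) (g' t) (h t).
  have := metric_triangle (g' t) (g t) (h t).
  by rewrite (metric_sym (g' t) (g t)) => ? ?; apply/andP; split; lra.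
apply: (cvg_trans _ (cvgD cgh diff0)); apply: near_eq_cvg.
by near=> t; rewrite /= addrC subrK.
Unshelve. all: by end_near. Qed.

Lemma alexandrov_angle_congr g h h' :
  alexandrov_angle h h' = 0 -> alexandrov_angle g h = alexandrov_angle g h'.
Proof.
by move=> hh'; rewrite !(alexandrov_angleC g) (alexandrov_angle_congl _ hh').
Qed.

Lemma direction_repr_of g :
  alexandrov_angle (direction_repr (direction_of g)) g = 0.
Proof.
rewrite /direction_repr; case: cid => k /= gk.
have : direction_class g g by exact: alexandrov_anglexx.
by rewrite gk.
Qed.

Lemma direction_angle_of g (D : direction x) :
  direction_angle (direction_of g) D = alexandrov_angle g (direction_repr D).
Proof. exact: alexandrov_angle_congl (direction_repr_of g). Qed.

End Angle.

(** * Uniqueness of segments, and scalar products with tangent vectors *)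

Lemma segment_unique (x y : X) (g h : R -> X) :
  is_segment x y g -> is_segment x y h ->
  forall t, 0 <= t <= mdist x y -> g t = h t.
Proof.
move=> [g0 gy gi] [h0 hy hi] t /andP[t0 tl].
have [l0|] := ltP 0 (mdist x y); last first.
  move=> l0; have -> : t = 0 by lra.
  by rewrite g0 h0.
have tl1 : 0 <= t / mdist x y <= 1.
  by rewrite divr_ge0 ?mdist_ge0 // ler_pdivrMr // mul1r.
(* The triangle [x, y, y] is degenerate, so the squared distance of [g t] and [h t] is bounded by
   0. *)
have := cat0_law_of_cosines g0 h0 gi hi l0 l0 tl1 tl1.
rewrite gy hy mdistxx divfK ?gt_eqF //.
have -> : t ^+ 2 + t ^+ 2 - t / mdist x y * (t / mdist x y) *
    (mdist x y ^+ 2 + mdist x y ^+ 2 - 0 ^+ 2) = 0.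
  by field; rewrite gt_eqF.
move=> sq0; apply: mdist_positivity; apply/eqP.
by rewrite -sqrf_eq0 eq_le sq0 sqr_ge0.
Qed.

Lemma geodesic_to_end (x : X) (g : geodesic_from x)
    (yx : g (geo_length g) != x) : alexandrov_angle g (geodesic_to yx) = 0.
Proof.
have l0 := geo_length_gt0 g.
have [gE gseg] :=
  is_segment_isometric (ltW l0) (geo_fun0 g) (@geo_funP _ _ _ g).
apply: (alexandrov_angle_eq0 l0) => t tl.
by apply: (segment_unique gseg (segmentP _ _)); rewrite gE.
Qed.

(** Links the scalar product of the cone to the terms of the mean deficit. The hypothesis on [D]
    fits both the direction of the segment to [y] and that of a geodesic ending at [y]. *)
Lemma cone_dot_tangent_vector (x a y : X) (yx : y != x)
    (D : direction x) (r : R) (r0 : 0 < r) :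
  a != x -> alexandrov_angle (direction_repr D) (geodesic_to yx) = 0 ->
  cone_dot (tangent_vector x a) (cone_point D r0) =
  r * (mdist a x * cos (angle a x y)).
Proof.
move=> ax Dy; rewrite /tangent_vector; case: pselect => // ax' /=.
by rewrite direction_angle_of (alexandrov_angle_congr _ Dy) /angle /=; ring.
Qed.

End CAT0Angle.

(** * Isometries from the tangent cone to Euclidean space *)

Section ConeIsometry.
Context {R : realType} {X : hadamardType R} {x : X} {n : nat}.
Context {phi : tangent_cone x -> 'rV[R]_n}.
Context (phi_isom : cone_isometry phi) (phi_apex : phi cone_apex = 0).

Lemma cone_isometry_norm u : euclid_norm (phi u) = cone_norm u.
Proof.
have := phi_isom.2 u cone_apex; rewrite /euclid_dist phi_apex subr0 => ->.
rewrite /cone_dist /=; have -> : cone_dot u cone_apex = 0 by case: u.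
rewrite mulr0 subr0 expr0n addr0 sqrtr_sqr ger0_norm //.
by case: u => //= D r r0; exact: ltW.
Qed.

(** Polarization: distances and norms determine the scalar product. The bound [dot_le] makes the
    radicand in [cone_dist] nonnegative, so that squaring undoes the root. *)
Lemma cone_isometry_dot u v : euclid_dot (phi u) (phi v) = cone_dot u v.
Proof.
have := phi_isom.2 u v.
have dot_le : 2 * cone_dot u v <= cone_norm u ^+ 2 + cone_norm v ^+ 2.
  case: u v => [|D r r0] [|E s s0] /=; rewrite ?mulr0 ?addr_ge0 ?sqr_ge0 //.
  have : r * s * cos (direction_angle D E) <= r * s.
    by rewrite ger_pMr ?mulr_gt0 // cos_le1.
  have := sqr_ge0 (r - s); lra.
move=> /(congr1 (fun z => z ^+ 2)) /=.
rewrite /euclid_dist -[- phi v]scaleN1r sqr_euclid_normD !cone_isometry_norm.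
by rewrite /cone_dist sqr_sqrtr ?subr_ge0 //; lra.
Qed.

End ConeIsometry.

(** * The mean deficit and the shortest convex combination *)

Theorem theorem7p12 (R : realType) (X : hadamardType R) (A : {fset X}) (x : X)
    (A_neq0 : A != fset0) (xNA : x \notin A)
    (n : nat) (phi : tangent_cone x -> 'rV[R]_n)
    (phi_isom : cone_isometry phi) (phi_apex : phi cone_apex = 0) :
  is_min
    [set euclid_norm (\sum_(a : A) w a *: phi (tangent_vector x (val a)))
      | w in [set w : A -> R |
               (forall a, 0 <= w a) /\ \sum_(a : A) w a = 1]]
    (mean_deficit A x).
Proof.
have [a0 a0A] := fset0Pn _ A_neq0.
pose i0 : A := [` a0A]%fset.
have Ax (a : A) : val a != x.
  by apply: contraNneq xNA => <-; exact: valP.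
pose v (a : A) := phi (tangent_vector x (val a)).
have [c [c0 c1 cmin]] := shortest_convex_combination i0 v.
set p := \sum_a c a *: v a in cmin.
suff -> : mean_deficit A x = euclid_norm p.
  split; first by exists c.
  by move=> _ [w [w0 w1] <-]; exact: cmin.
have dotE y (yx : y != x) D (Dy : alexandrov_angle (direction_repr D)
    (geodesic_to yx) = 0) r (r0 : 0 < r) (a : A) :
  euclid_dot (v a) (phi (cone_point D r0)) =
  r * (mdist (val a) x * cos (angle (val a) x y)).
  rewrite (cone_isometry_dot phi_isom phi_apex).
  exact: cone_dot_tangent_vector.
rewrite /mean_deficit; set S := [set m | _].
have S_ub : ubound S (euclid_norm p).
  move=> m [y yx [_ m_lb]].
  set u := phi (cone_point (direction_of (geodesic_to yx)) ltr01).
  apply: (@le_trans _ _ (euclid_dot p u)); last first.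
    apply: euclid_dot_le_norm.
    by rewrite (cone_isometry_norm phi_isom phi_apex).
  rewrite euclid_dot_suml -[m]mul1r -c1 mulr_suml.
  apply: ler_sum => a _; apply: ler_wpM2l => //.
  rewrite (dotE _ yx) ?mul1r; last exact: direction_repr_of.
  by apply: m_lb; exists (val a); first exact: valP.
have := euclid_norm_ge0 p; rewrite le_eqVlt => /orP[/eqP p0|p_gt0].
  rewrite -p0; apply/max_idPr.
  (* If [p = 0], the supremum is at most 0; on the empty set [sup] takes the value 0. *)
  have [S0|/set0P/negP/negPn/eqP ->] := pselect (S !=set0).
    by rewrite p0; exact: ge_sup.
  by rewrite sup0.
(* Surjectivity of [phi] realizes [p] in the cone; its positive norm excludes the apex. *)
have [[phi' _ phiK] _] := phi_isom.
have : phi (phi' p) = p by exact: phiK.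
case: (phi' p) => [|D r r0] phi_p.
  by move: p_gt0; rewrite -phi_p (cone_isometry_norm phi_isom phi_apex) ltxx.
have rE : r = euclid_norm p.
  by rewrite -phi_p (cone_isometry_norm phi_isom phi_apex).
pose g := direction_repr D.
have yx : g (geo_length g) != x.
  rewrite eq_sym -mdist_gt0 geo_dist ?geo_length_gt0 //.
  by rewrite lexx andbT ltW // geo_length_gt0.
pose F (a : A) := mdist (val a) x * cos (angle (val a) x (g (geo_length g))).
have F_ge a : euclid_norm p <= F a.
  rewrite -(ler_pM2l p_gt0) -expr2.
  apply: (le_trans (shortest_convex_combination_dot a c0 c1 cmin)).
  by rewrite -/p -{1}phi_p (dotE _ yx) ?rE //; exact: geodesic_to_end.
(* The minimum over the finite set [A] is attained, so [F a] belongs to [S], and it is at least the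
   norm of [p]. *)
have [a _ a_min] := arg_minP F (isT : xpredT i0).
have SFa : S (F a).
  exists (g (geo_length g)) => //; split.
    by exists (val a) => //; exact: valP.
  by move=> _ [b bA <-]; exact: (a_min [` bA]%fset).
apply/eqP; rewrite eq_le; apply/andP; split.
  rewrite ge_max euclid_norm_ge0 andbT.
  by apply: ge_sup => //; exists (F a).
rewrite le_max; apply/orP; left; apply: (le_trans (F_ge a)).
by apply: ub_le_sup SFa; exists (euclid_norm p).
Qed.
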